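(* Let $C_{\vec B}$ and $C_{\vec C}$ be Cantor sets with scale factors $M$ and $N$ respectively, and suppose $M$ and $N$ are multiplicatively independent. Then $\mu_{\vec B}(C_{\vec B}\cap C_{\vec C})=0$ and $\mu_{\vec C}(C_{\vec B}\cap C_{\vec C})=0$.
   Context: A Cantor set is specified by an integer scale factor $N\ge 3$ and a digit set $D\subset\{0,1,\dots,N-1\}$ with $2\le |D|\le N-1$; equivalently by its binary digit vector $\vec B=(b_0,\dots,b_{N-1})\in\{0,1\}^N$ with $b_i=1$ iff $i\in D$, and $\|\vec B\|:=\sum_i b_i$. With $\phi_d(x)=(x+d)/N$ for $d\in D$, the Cantor set $C_{\vec B}\subset[0,1]$ is the unique nonempty compact set with $C_{\vec B}=\bigcup_{d\in D}\phi_d(C_{\vec B})$, and $\mu_{\vec B}$ is the unique Borel probability measure with $\mu_{\vec B}=\frac{1}{\|\vec B\|}\sum_{d\in D}\mu_{\vec B}\circ\phi_d^{-1}$ (supported on $C_{\vec B}$). Two integers $r,s$ are multiplicatively dependent if there exist integers $m,n$, not both zero, with $r^m=s^n$; otherwise they are multiplicatively independent. *)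

(* Defs.v *)
From HB Require Import structures.
From mathcomp Require Import all_boot all_order all_algebra.
From mathcomp Require Import all_classical all_reals all_analysis.
Set Implicit Arguments. Unset Strict Implicit. Unset Printing Implicit Defensive.
Import Order.TTheory GRing.Theory Num.Theory.
Import numFieldNormedType.Exports.
Local Open Scope classical_set_scope.
Local Open Scope ring_scope.

Definition cphi {R : realType} (N d : nat) (x : R) : R := (x + d%:R) / N%:R.

Definition cantor_data (N : nat) (D : {set 'I_N}) : Prop :=
  (3 <= N)%N /\ (2 <= #|D|)%N /\ (#|D| <= N.-1)%N.

(* K is the Cantor set C_B: nonempty compact with K = U_{d in D} phi_d(K).
   (Such K exists and is unique, so it is the attractor.) *)
Definition is_cantor_set {R : realType} (N : nat) (D : {set 'I_N})
    (K : set R) : Prop :=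
  compact K /\ K !=set0 /\
  K = \bigcup_(d in [set d : 'I_N | d \in D]) (cphi N (nat_of_ord d) @` K).

(* mu is the Cantor measure mu_B: a Borel probability measure on R with
   mu = (1/|D|) sum_{d in D} mu o phi_d^{-1}. (It exists and is unique.) *)
Definition is_cantor_measure {R : realType} (N : nat) (D : {set 'I_N})
    (mu : probability R R) : Prop :=
  forall A : set R, measurable A ->
    mu A = (((#|D|%:R)^-1 : R)%:E *
           \sum_(d in D) mu (cphi N (nat_of_ord d) @^-1` A))%E.

Definition mult_independent (r s : nat) : Prop :=
  forall m n : int, (r%:Q ^ m = s%:Q ^ n)%R -> m = 0%R /\ n = 0%R.

(* Main.v *)
Require Import Defs.
From HB Require Import structures.
From mathcomp Require Import all_boot all_order all_algebra.
From mathcomp Require Import all_classical all_reals all_analysis.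
From mathcomp Require Import measurable_realfun ring lra.

(** Let [F] be the squared modulus of the Fourier transform of [mu_B], and [P]
    the normalised squared modulus of the exponential sum of its digits.
    Self-similarity gives [F xi = P (xi / M) * F (xi / M)] with [P <= 1], hence
    [F (2 pi g N^k) <= F (2 pi g N^k / M^a)] for all [a].  By multiplicative
    independence the numbers [N^k / M^a] are dense in the positive reals, so [k]
    can be chosen such that [F (2 pi g N^k)] is small for all [g] in a given
    finite set of positive integers.  Thus, with [H] fixed and [k] suitable, the
    exponentials of frequency [2 pi h N^(k+i)], [i < H], are almost orthogonal in
    [L^2 (mu_B)].  On the other hand all [N^(k+i) x] with [x] in [C_C] avoid,
    modulo 1, a fixed interval, and testing this against a Fejer kernel bounds
    the averages over [i] of these exponentials from below on [C_C].  Comparing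
    the two estimates yields [mu_B (C_C) = O(1 / H)]. *)

Set Implicit Arguments.
Unset Strict Implicit.
Unset Printing Implicit Defensive.
Import Order.TTheory GRing.Theory Num.Theory.
Import numFieldNormedType.Exports.
Local Open Scope classical_set_scope.
Local Open Scope ring_scope.

(** * Trigonometric sums *)

(** Both sides are the squared modulus of the sum of the [e^(i x_j)]. It is applied to the digits of
    a Cantor set and to the orbit of a point. *)
Lemma sqr_sum_cos_sin (R : realType) (I : finType) (P : pred I) (x : I -> R) :
  (\sum_(i | P i) cos (x i)) ^+ 2 + (\sum_(i | P i) sin (x i)) ^+ 2 =
  \sum_(i | P i) \sum_(j | P j) cos (x i - x j).
Proof.
rewrite !expr2 !mulr_suml -big_split /=; apply: eq_bigr => i _.
rewrite !mulr_sumr -big_split /=; apply: eq_bigr => j _.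
by rewrite cosB.
Qed.

Lemma cosD2pin (R : realType) (x : R) (n : nat) : cos (x + (pi *+ 2) * n%:R) = cos x.
Proof. by rewrite mulr_natr periodicn //; exact: cosD2pi. Qed.

Lemma cos_lt1 (R : realType) (x : R) : 0 < x < pi *+ 2 -> cos x < 1.
Proof.
move=> /andP[x0 x2].
have -> : x = (x / 2) *+ 2 by rewrite -mulr_natr; field.
rewrite cos_mulr2n cos2sin2.
have : 0 < sin (x / 2).
  by apply: sin_gt0_pi; move: x2; rewrite -mulr_natr => x2; apply/andP; split; lra.
move=> s0; have : 0 < sin (x / 2) ^+ 2 by exact: exprn_gt0.
rewrite -mulr_natr; lra.
Qed.

(** The second factor is the squared modulus of the sum of [e^(i h t)] over [h < n], which is [n]
    times the Fejer kernel. Multiplying by [1 - cos t] avoids dividing by zero at the multiples of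
    [2 pi]. *)
Lemma fejer_kernel (R : realType) (n : nat) (t : R) :
  (1 - cos t) * (n%:R + 2 * \sum_(1 <= h < n) (n%:R - h%:R) * cos (h%:R * t)) =
  1 - cos (n%:R * t).
Proof.
(* The Dirichlet kernel is the increment of the second factor from [m] to [m + 1], so the right-hand
   sides telescope. *)
have dirichlet m : (1 - cos t) * (1 + 2 * \sum_(1 <= h < m.+1) cos (h%:R * t)) =
    cos (m%:R * t) - cos (m.+1%:R * t).
  elim: m => [|m IH]; first by rewrite big_geq // mul0r cos0 mul1r; ring.
  rewrite big_nat_recr //= [X in _ * X](_ : _ =
    (1 + 2 * \sum_(1 <= h < m.+1) cos (h%:R * t)) + 2 * cos (m.+1%:R * t)); last by ring.
  rewrite mulrDr IH.
  have e1 : m%:R * t = m.+1%:R * t - t by rewrite -natr1; ring.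
  have e2 : m.+2%:R * t = m.+1%:R * t + t by rewrite -natr1; ring.
  rewrite e1 e2 cosB cosD; ring.
elim: n => [|n IH]; first by rewrite big_geq // mul0r cos0; ring.
case: n IH => [|n] IH; first by rewrite big_geq // mul1r; ring.
rewrite big_nat_recr //= [X in _ * X](_ : _ =
  (n.+1%:R + 2 * \sum_(1 <= h < n.+1) (n.+1%:R - h%:R) * cos (h%:R * t)) +
  (1 + 2 * \sum_(1 <= h < n.+2) cos (h%:R * t))).
  rewrite mulrDr IH dirichlet; ring.
rewrite [X in _ = _ + (1 + 2 * X)]big_nat_recr //=.
have -> : \sum_(1 <= h < n.+1) (n.+2%:R - h%:R) * cos (h%:R * t) =
  \sum_(1 <= h < n.+1) (n.+1%:R - h%:R) * cos (h%:R * t) +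
  \sum_(1 <= h < n.+1) cos (h%:R * t).
  rewrite -big_split /=; apply: eq_bigr => h _; rewrite -[n.+2%:R]natr1; ring.
rewrite -[n.+2%:R]natr1; ring.
Qed.

(** * Density of the ratios of powers *)

Lemma independent_powX_neq (M N k a : nat) : mult_independent M N ->
  (0 < k)%N -> (N ^ k != M ^ a)%N.
Proof.
move=> ind k0; apply/eqP => e.
have /ind[_ [k00]] : (M%:Q ^ (a%:Z) = N%:Q ^ (k%:Z))%R.
  by rewrite -!exprnP -!natrX e.
by rewrite k00 in k0.
Qed.

(* Pigeonhole on the fractional parts of [k * x / y], [k = 0, ..., n]. *)
Lemma small_nat_combination (R : realType) (x y e : R) :
  0 < x -> 0 < y -> 0 < e ->
  exists k a : nat, (0 < k)%N /\ `|x * k%:R - y * a%:R| < e.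
Proof.
move=> x0 y0 e0.
pose q k := Num.trunc (k%:R * x / y).
pose fr k := k%:R * x / y - (q k)%:R.
have frP k : 0 <= fr k < 1.
  have /andP[] : (q k)%:R <= k%:R * x / y < (q k).+1%:R.
    by apply: truncn_itv; rewrite divr_ge0 ?mulr_ge0 // ltW.
  by rewrite /fr -natr1; lra.
(* Two fractional parts in the same one of [n] boxes differ by less than [1 / n], and [n > y / e]
   makes [y / n < e]. *)
pose n := (Num.trunc (y / e)).+1.
have n0 : 0 < n%:R :> R by rewrite ltr0n.
have yn : y < e * n%:R.
  by rewrite -ltr_pdivrMl // mulrC; apply: truncnS_gt.
have boxP k : (Num.trunc (n%:R * fr k) < n)%N.
  have /andP[f0 f1] := frP k.
  by rewrite truncn_lt_nat ?mulr_ge0 ?(ltW n0) // gtr_pMr.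
pose box (k : 'I_n.+1) : 'I_n := Ordinal (boxP k).
have : ~~ injectiveb box.
  apply/negP => /injectiveP /leq_card; by rewrite !card_ord ltnn.
case/injectivePn => i [j ij bij].
wlog lij : i j ij bij / (i < j)%N.
  move=> W; case: (ltngtP i j) => [l|l|e1]; first exact: (W i j).
    by apply: (W j i) => //; rewrite eq_sym.
  by move: ij; rewrite (val_inj e1) eqxx.
exists (j - i)%N, (q j - q i)%N; split; first by rewrite subn_gt0.
have qij : (q i <= q j)%N.
  apply: le_truncn; rewrite ler_pM2r ?invr_gt0 // ler_pM2r // ler_nat; exact: ltnW.
rewrite natrB ?(ltnW lij) // natrB //.
have -> : x * (j%:R - i%:R) - y * ((q j)%:R - (q i)%:R) = y * (fr j - fr i).
  rewrite /fr; field; exact: lt0r_neq0.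
rewrite normrM gtr0_norm //.
have : n%:R * `|fr j - fr i| < 1.
  rewrite -[X in X * _](@gtr0_norm _ n%:R) // -normrM mulrBr.
  have {}bij := congr1 val bij; rewrite /= in bij.
  have /andP[fi0 _] := frP i; have /andP[fj0 _] := frP j.
  have := @truncn_itv _ (n%:R * fr i); have := @truncn_itv _ (n%:R * fr j).
  rewrite -bij => /(_ (mulr_ge0 (ltW n0) fj0)) + /(_ (mulr_ge0 (ltW n0) fi0)).
  rewrite -natr1 ltr_norml => /andP[? ?] /andP[? ?]; apply/andP; split; lra.
move=> h; apply: le_lt_trans (_ : e * n%:R * `|fr j - fr i| < _).
  by rewrite ler_wpM2r // ltW.
by rewrite -mulrA gtr_pMr.
Qed.

(** A small nonzero combination [d] has multiples [d * j] close to any target with the sign of [d].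
    The target [s] is given that sign by subtracting a multiple of [x] or adding a multiple of [y],
    which keeps both coefficients natural. *)
Lemma nat_combination_dense (R : realType) (x y s e : R) :
  0 < x -> 0 < y -> 0 < e ->
  (forall k a : nat, (0 < k)%N -> x * k%:R != y * a%:R) ->
  exists k a : nat, `|x * k%:R - y * a%:R - s| < e.
Proof.
move=> x0 y0 e0 irr.
have [k [a [k0 small]]] := small_nat_combination x0 y0 e0.
pose d := x * k%:R - y * a%:R.
have d0 : d != 0 by rewrite subr_eq0 irr.
have step (z : R) : 0 <= z / d -> exists j : nat, `|d * j%:R - z| < e.
  move=> zd; exists (Num.trunc (z / d)).
  have -> : d * (Num.trunc (z / d))%:R - z = d * ((Num.trunc (z / d))%:R - z / d).
    by rewrite mulrBr (mulrC d (z / d)) divfK.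
  rewrite normrM; apply: le_lt_trans small; rewrite -/d ler_piMr //.
  have := truncn_itv zd; move: (z / d) => w; rewrite -natr1 => /andP[? ?].
  by rewrite ler_norml; apply/andP; split; lra.
have big (z w : R) : 0 < z -> exists j : nat, w <= z * j%:R.
  move=> z0; exists (Num.trunc (`|w| / z)).+1.
  apply: le_trans (ler_norm w) _.
  by rewrite mulrC -ler_pdivrMr //; apply/ltW/truncnS_gt.
case: (ltgtP d 0) d0 => // dd _.
  have [b hb] := big x s x0.
  have [j hj] : exists j : nat, `|d * j%:R - (s - x * b%:R)| < e.
    by apply: step; rewrite ler_ndivlMr // mul0r subr_le0.
  exists (b + k * j)%N, (a * j)%N; move: hj; rewrite /d.
  by rewrite natrD !natrM; congr (`|_| < _); ring.
have [b hb] := big y (- s) y0.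
have [j hj] : exists j : nat, `|d * j%:R - (s + y * b%:R)| < e.
  by apply: step; apply: divr_ge0 (ltW dd); lra.
exists (k * j)%N, (b + a * j)%N; move: hj; rewrite /d.
by rewrite natrD !natrM; congr (`|_| < _); ring.
Qed.

(** Taking logarithms reduces this to the combinations of [ln N] and [ln M]; independence gives the
    required irrationality, and continuity of [expR] at [ln s] transfers the approximation back. *)
Lemma pow_ratio_dense (R : realType) (M N : nat) (s e : R) :
  (1 < M)%N -> (1 < N)%N -> mult_independent M N -> 0 < s -> 0 < e ->
  exists k a : nat, `|N%:R ^+ k / M%:R ^+ a - s| < e.
Proof.
move=> M1 N1 ind s0 e0.
have lnM : 0 < ln (M%:R : R) by rewrite ln_gt0 // ltr1n.
have lnN : 0 < ln (N%:R : R) by rewrite ln_gt0 // ltr1n.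
have Mp : (M%:R : R) \is Num.pos by rewrite posrE ltr0n ltnW.
have Np : (N%:R : R) \is Num.pos by rewrite posrE ltr0n ltnW.
have ctn : {for ln s, continuous (@expR R)} by exact: continuous_expR.
have : \forall z \near ln s, `|expR (ln s) - expR z| < e.
  exact: (@cvgr_dist_lt _ _ _ _ _ _ _ ctn _ e0).
case=> d /= d0 near_s.
have [|k [a hka]] := nat_combination_dense (ln s) lnN lnM d0.
  move=> k a k0; apply/negP => /eqP e1.
  have := independent_powX_neq a ind k0.
  rewrite -(eqr_nat R) => /negP; apply; apply/eqP.
  apply: ln_inj; rewrite ?posrE ?ltr0n ?expn_gt0 ?(ltnW M1) ?(ltnW N1) //.
  rewrite !natrX !lnXn ?ltr0n ?(ltnW M1) ?(ltnW N1) //.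
  by rewrite -[LHS]mulr_natr -[RHS]mulr_natr.
exists k, a.
have := near_s (ln N%:R * k%:R - ln M%:R * a%:R); rewrite /= distrC => /(_ hka).
rewrite lnK ?posrE // distrC; congr (`|_ - _| < _).
rewrite expRB; congr (_ / _); rewrite mulr_natr -lnXn ?lnK ?posrE ?exprn_gt0 //.
Qed.

(** * Integration against Cantor measures *)

Lemma measurable_cphi (R : realType) (N d : nat) :
  measurable_fun [set: R] (@cphi R N d).
Proof.
apply: continuous_measurable_fun => x.
by apply: cvgM; [apply: cvgD; [exact: cvg_id|exact: cvg_cst]|exact: cvg_cst].
Qed.

(** Self-similarity says that [mu] is a scaled finite sum of pushforwards of itself. For nonnegative
    [f] the integral splits along this sum without integrability conditions. *)
Lemma ge0_cantor_measure_integral (R : realType) (N : nat) (D : {set 'I_N})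
    (mu : probability R R) (f : R -> R) :
  is_cantor_measure D mu -> measurable_fun setT f -> (forall x, 0 <= f x) ->
  (\int[mu]_x (f x)%:E = ((#|D|%:R)^-1 : R)%:E *
    \sum_(d in D) \int[mu]_x (f (cphi N d x))%:E)%E.
Proof.
move=> muD mf f0.
have mef : measurable_fun setT (EFin \o f) by exact/measurable_EFinP.
have k0 : 0 <= (#|D|%:R)^-1 :> R by rewrite invr_ge0.
(* [msum] adds up a sequence of measures, so the digits are listed by naturals; the default 0 occurs
   only for [n >= #|D|], outside the sum. *)
pose digit (n : nat) : nat := nth 0%N [seq val d | d <- enum D] n.
pose push n : {measure set R -> \bar R} := pushforward mu (@cphi R N (digit n)).
pose m_ := push (fun n => measurable_cphi N (digit n)).
have sumE (g : nat -> \bar R) :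
    (\sum_(d in D) g d = \sum_(n < #|D|) g (digit n))%E.
  rewrite big_enum_val; apply: eq_bigr => i _; congr g.
  by rewrite /digit (nth_map (enum_val i)) -?cardE // -enum_val_nth.
transitivity (\int[mscale (NngNum k0) (msum m_ #|D|)]_x (f x)%:E)%E.
  apply: eq_measure_integral => A mA _.
  apply: etrans (muD A mA) _.
  by rewrite /mscale /= /msum (sumE (fun d => mu (cphi N d @^-1` A))).
rewrite ge0_integral_mscale //; last by move=> x _; rewrite lee_fin.
rewrite ge0_integral_measure_sum //; last by move=> x _; rewrite lee_fin.
rewrite (sumE (fun d => \int[mu]_x (f (cphi N d x))%:E)%E).
congr (_ * _)%E; apply: eq_bigr => n _.
rewrite ge0_integral_pushforward //; first exact: measurable_cphi.
by move=> x _; rewrite lee_fin.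
Qed.

(** * Integration of bounded continuous functions *)

Section Bounded.
Variables (R : realType) (mu : probability R R).

Definition bcont (f : R -> R) := continuous f /\ exists b, forall x, `|f x| <= b.

Lemma bcont_integrable f : bcont f -> mu.-integrable setT (EFin \o f).
Proof.
move=> [cf [b fb]]; apply: measurable_bounded_integrable => //.
- exact: le_lt_trans (probability_le1 mu measurableT) (ltry 1).
- exact: continuous_measurable_fun.
- exists b; split; first exact: num_real.
  by move=> x bx y _; apply: le_trans (fb y) (ltW bx).
Qed.

Lemma bcont_cst c : bcont (fun=> c).
Proof. by split; [move=> x; exact: cvg_cst | exists `|c|]. Qed.

Lemma bcontD f g : bcont f -> bcont g -> bcont (fun x => f x + g x).
Proof.
move=> [cf [a fa]] [cg [b gb]]; split; first by move=> x; apply: cvgD; [exact: cf|exact: cg].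
by exists (a + b) => x; apply: le_trans (ler_normD _ _) (lerD (fa x) (gb x)).
Qed.

Lemma bcontZ c f : bcont f -> bcont (fun x => c * f x).
Proof.
move=> [cf [a fa]]; split.
  by move=> x; apply: cvgM; [exact: cvg_cst|exact: cf].
by exists (`|c| * a) => x; rewrite normrM ler_wpM2l.
Qed.

Lemma bcont_sum (I : Type) (s : seq I) (P : pred I) (f : I -> R -> R) :
  (forall i, bcont (f i)) -> bcont (fun x => \sum_(i <- s | P i) f i x).
Proof.
move=> tf; elim: s => [|i s IH].
  rewrite (_ : (fun _ => _) = fun=> 0); first exact: bcont_cst.
  by apply/funext => x; rewrite big_nil.
rewrite (_ : (fun _ => _) = fun x => (if P i then f i x else 0) + \sum_(j <- s | P j) f j x).
  by apply: bcontD => //; case: (P i) => //; exact: bcont_cst.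
by apply/funext => x; rewrite big_cons; case: (P i); rewrite ?add0r.
Qed.

Lemma bcont_cos a : bcont (fun x => cos (a * x)).
Proof.
split; last by exists 1 => x; exact: cos_max.
by move=> x; apply: continuous_comp; [exact: mulrl_continuous|exact: continuous_cos].
Qed.

Lemma bcont_sin a : bcont (fun x => sin (a * x)).
Proof.
split; last by exists 1 => x; exact: sin_max.
by move=> x; apply: continuous_comp; [exact: mulrl_continuous|exact: continuous_sin].
Qed.

Lemma bcont_cphi N d f : bcont f -> bcont (fun x => f (cphi N d x)).
Proof.
move=> [cf [b fb]]; split; last by exists b => x; exact: fb.
move=> x; apply: (@continuous_comp _ _ _ (cphi N d) f x); last exact: cf.
by apply: cvgM; [apply: cvgD; [exact: cvg_id|exact: cvg_cst]|exact: cvg_cst].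
Qed.

Lemma Rintegral_sum (I : Type) (s : seq I) (P : pred I) (f : I -> R -> R) :
  (forall i, bcont (f i)) ->
  \int[mu]_x (\sum_(i <- s | P i) f i x) = \sum_(i <- s | P i) \int[mu]_x f i x.
Proof.
move=> tf; elim: s => [|i s IH].
  rewrite big_nil -[RHS](mul0r (fine (mu setT))) -Rintegral_cst //.
  by apply: eq_Rintegral => x _; rewrite big_nil.
rewrite big_cons -IH; case: ifP => Pi.
  rewrite -RintegralD //; [|exact: bcont_integrable|exact/bcont_integrable/bcont_sum].
  by apply: eq_Rintegral => x _; rewrite big_cons Pi.
by apply: eq_Rintegral => x _; rewrite big_cons Pi.
Qed.

Lemma Rintegral_prob_cst c : \int[mu]_x (fun=> c) x = c.
Proof.
rewrite Rintegral_cst // (_ : fine _ = 1) ?mulr1 //.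
by have /= := probability_setT mu => ->.
Qed.

Lemma cantor_measure_integral (N : nat) (D : {set 'I_N}) (f : R -> R) :
  is_cantor_measure D mu -> (0 < #|D|)%N -> bcont f ->
  \int[mu]_x f x = (#|D|%:R)^-1 * \sum_(d in D) \int[mu]_x f (cphi N d x).
Proof.
move=> muD D0 tf; have [cf [b fb]] := tf.
(* Adding the bound [b] makes the integrand nonnegative. It contributes [b] to both sides, since the
   right-hand side averages over [#|D|] digits. *)
pose g x := f x + b.
have tg : bcont g by apply: bcontD => //; exact: bcont_cst.
have gint h : bcont h -> \int[mu]_x (h x + b) = \int[mu]_x h x + b.
  move=> th; rewrite RintegralD //; [|exact: bcont_integrable|exact/bcont_integrable/bcont_cst].
  by rewrite Rintegral_prob_cst.
have g0 x : 0 <= g x by have := fb x; rewrite ler_norml => /andP[+ _]; rewrite -[- b]sub0r lerBlDr.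
suff : \int[mu]_x g x = (#|D|%:R)^-1 * \sum_(d in D) \int[mu]_x g (cphi N d x).
  rewrite /g gint //.
  under eq_bigr => d _ do rewrite (gint (fun x => f (cphi N d x)) (bcont_cphi _ _ tf)).
  rewrite big_split /= sumr_const mulrDr -(mulr_natl b) mulrA mulVf ?pnatr_eq0 -?lt0n // mul1r.
  by move/addIr.
rewrite /Rintegral (ge0_cantor_measure_integral muD) //.
  2: { exact: (continuous_measurable_fun tg.1). }
have fin d : (\int[mu]_x (g (cphi N d x))%:E)%E \is a fin_num.
  by apply: integrable_fin_num => //; exact: (bcont_integrable (bcont_cphi _ _ tg)).
rewrite fineM //; last by apply/sum_fin_numP => d _ _; exact: fin.
by congr (_ * _); rewrite -sum_fine // => d _; exact: fin.
Qed.

End Bounded.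

(** * Fourier decay *)

Lemma Rintegral_lin (R : realType) (mu : probability R R) (a b : R) (f g : R -> R) :
  bcont f -> bcont g ->
  \int[mu]_x (a * f x + b * g x) = a * \int[mu]_x f x + b * \int[mu]_x g x.
Proof.
move=> tf tg; rewrite RintegralD ?RintegralZl //;
  apply: bcont_integrable => //; exact: bcontZ.
Qed.

(** The function [F] of the introduction, in real terms. *)
Definition fourier_energy (R : realType) (mu : probability R R) (xi : R) : R :=
  (\int[mu]_x cos (xi * x)) ^+ 2 + (\int[mu]_x sin (xi * x)) ^+ 2.

(** The function [P] of the introduction, normalised to take the value 1 at 0. *)
Definition mask_energy (R : realType) (N : nat) (D : {set 'I_N}) (y : R) : R :=
  ((\sum_(d in D) cos (d%:R * y)) ^+ 2 + (\sum_(d in D) sin (d%:R * y)) ^+ 2)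
  / #|D|%:R ^+ 2.

Lemma mask_energy_ge0 (R : realType) (N : nat) (D : {set 'I_N}) (y : R) :
  0 <= mask_energy D y.
Proof. by rewrite divr_ge0 ?exprn_ge0 // addr_ge0 ?sqr_ge0. Qed.

Lemma mask_energyD2pin (R : realType) (N : nat) (D : {set 'I_N}) (y : R) (m : nat) :
  mask_energy D (y + (pi *+ 2) * m%:R) = mask_energy D y.
Proof.
rewrite /mask_energy; congr ((_ ^+ 2 + _ ^+ 2) / _); apply: eq_bigr => d _;
  rewrite mulrDr mulrCA -natrM mulr_natr periodicn //; [exact: cosD2pi|exact: sinD2pi].
Qed.

(** The double sum has [#|D|^2] terms, all nonnegative, so the deficit from 1 can be read off pair
    by pair. *)
Lemma mask_energyE (R : realType) (N : nat) (D : {set 'I_N}) (y : R) :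
  (0 < #|D|)%N -> 1 - mask_energy D y =
  (\sum_(i in D) \sum_(j in D) (1 - cos ((i%:R - j%:R) * y))) / #|D|%:R ^+ 2.
Proof.
move=> D0; have Dn0 : (#|D|%:R : R) != 0 by rewrite pnatr_eq0 -lt0n.
under eq_bigr => i _ do [rewrite sumrB sumr_const; under eq_bigr => j _ do rewrite mulrBl].
rewrite sumrB sumr_const -mulrnA mulrBl /mask_energy sqr_sum_cos_sin; congr (_ - _).
by rewrite natrM -expr2 divff // expf_neq0.
Qed.

Lemma mask_energy_le1 (R : realType) (N : nat) (D : {set 'I_N}) (y : R) :
  (0 < #|D|)%N -> mask_energy D y <= 1.
Proof.
move=> D0; rewrite -subr_ge0 mask_energyE // divr_ge0 ?exprn_ge0 //.
by apply: sumr_ge0 => i _; apply: sumr_ge0 => j _; rewrite subr_ge0 cos_le1.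
Qed.

(** Two distinct digits differ by less than [N], so their phase difference lies strictly between 0
    and [2 pi] in absolute value and their term in the deficit is positive. *)
Lemma mask_energy_lt1 (R : realType) (N : nat) (D : {set 'I_N}) (y : R) :
  (1 < #|D|)%N -> 0 < y -> y * N%:R <= pi *+ 2 -> mask_energy D y < 1.
Proof.
move=> D1 y0 yN; rewrite -subr_gt0 mask_energyE; last exact: ltnW.
rewrite divr_gt0 ?exprn_gt0 ?ltr0n ?(ltnW D1) //.
have /card_gt1P[i [j [iD jD ij]]] := D1.
have ge (a b : 'I_N) : 0 <= 1 - cos ((a%:R - b%:R) * y) by rewrite subr_ge0 cos_le1.
rewrite (bigD1 i) //= (bigD1 j) //= ltr_pwDl //; last first.
  by apply: sumr_ge0 => a _; apply: sumr_ge0.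
rewrite ltr_pwDl //; last by apply: sumr_ge0.
rewrite subr_gt0 -cos_norm normrM (gtr0_norm y0); apply: cos_lt1.
have ij0 : 0 < `|i%:R - j%:R : R|.
  by rewrite normr_gt0 subr_eq0 eqr_nat; apply: contra ij => /eqP /val_inj ->.
rewrite mulr_gt0 //=; apply: lt_le_trans yN.
rewrite mulrC ltr_pM2l //.
have := ltn_ord i; have := ltn_ord j; rewrite -!(ltr_nat R).
have : 0 <= (i%:R : R) by []; have : 0 <= (j%:R : R) by [].
by move=> *; rewrite ltr_norml; apply/andP; split; lra.
Qed.

Lemma mask_energy_continuous (R : realType) (N : nat) (D : {set 'I_N}) :
  continuous (mask_energy D : R -> R).
Proof.
have cs (h : nat -> R -> R) : (forall d, bcont (h d)) ->
    continuous (fun y => (\sum_(d in D) h d y) ^+ 2).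
  move=> ch y; apply: (@continuous_comp _ _ _ (fun y => \sum_(d in D) h d y)
    (fun z : R => z ^+ 2)); last exact: exprn_continuous.
  exact: (bcont_sum _ _ (fun d : 'I_N => ch d)).1.
move=> y; apply: cvgM; last exact: cvg_cst.
by apply: cvgD; [apply: (cs (fun d y => cos (d%:R * y))) => d; exact: bcont_cos|
  apply: (cs (fun d y => sin (d%:R * y))) => d; exact: bcont_sin].
Qed.

(** By compactness the maximum on [[a, 2 pi / N]] is attained, and it is below 1 there. *)
Lemma mask_energy_bound (R : realType) (N : nat) (D : {set 'I_N}) (a : R) :
  (1 < #|D|)%N -> 0 < a -> a * N%:R <= pi *+ 2 ->
  exists2 rho : R, 0 <= rho < 1 &
    forall y, a <= y -> y * N%:R <= pi *+ 2 -> mask_energy D y <= rho.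
Proof.
move=> D1 a0 aN.
have N0 : (0 : R) < N%:R.
  rewrite ltr0n; apply: leq_trans (ltnW D1) _.
  by rewrite -[N in (_ <= N)%N]card_ord max_card.
have ab : a <= (pi *+ 2) / N%:R by rewrite ler_pdivlMr.
have [|c + cmax] := @EVT_max R (mask_energy D) _ _ ab.
  by apply: continuous_subspaceT; exact: mask_energy_continuous.
rewrite in_itv /= => /andP[ac cb]; exists (mask_energy D c).
  by rewrite mask_energy_ge0 mask_energy_lt1 ?(lt_le_trans a0) // -ler_pdivlMr.
by move=> y ay yN; apply: cmax; rewrite in_itv /= ay ler_pdivlMr.
Qed.

Section Decay.
Variables (R : realType) (M : nat) (D : {set 'I_M}) (mu : probability R R).
Hypothesis muD : is_cantor_measure D mu.
Hypothesis D1 : (1 < #|D|)%N.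

Let F := fourier_energy mu.

Let M1 : (1 < M)%N.
Proof. by apply: leq_trans D1 _; rewrite -[M in (_ <= M)%N]card_ord max_card. Qed.

Let M0 : (0 : R) < M%:R.
Proof. by rewrite ltr0n ltnW. Qed.

Lemma fourier_energy_ge0 xi : 0 <= F xi.
Proof. by rewrite addr_ge0 ?sqr_ge0. Qed.

Lemma fourier_energy_le2 xi : F xi <= 2.
Proof.
have bound f : bcont f -> (forall x, `|f x| <= 1) -> (\int[mu]_x f x) ^+ 2 <= 1.
  move=> tf f1; rewrite -[_ ^+ 2]ger0_norm ?sqr_ge0 // normrX expr_le1 //.
  have cst_int c : mu.-integrable setT (EFin \o (fun=> c)) := bcont_integrable mu (bcont_cst c).
  have f_int := bcont_integrable mu tf.
  have lo := le_Rintegral measurableT (cst_int (-1)) f_int.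
  have hi := le_Rintegral measurableT f_int (cst_int 1).
  rewrite !Rintegral_prob_cst in lo hi.
  rewrite ler_norml lo ?hi // => x _; by have := f1 x; rewrite ler_norml => /andP[].
apply: lerD; apply: bound;
  [exact: bcont_cos|by move=> x; exact: cos_max
  |exact: bcont_sin|by move=> x; exact: sin_max].
Qed.

(** With [y = xi / M], the phase [xi * cphi M d x] is [d * y + y * x]; hence the Fourier transform
    at [xi] is the averaged digit sum at [y] times the transform at [y]. *)
Lemma fourier_energy_selfsimilar xi :
  F xi = mask_energy D (xi / M%:R) * F (xi / M%:R).
Proof.
have D0 := ltnW D1.
have Dn0 : (#|D|%:R : R) != 0 by rewrite pnatr_eq0 -lt0n.
set y := xi / M%:R.
have e d x : xi * cphi M d x = d%:R * y + y * x by rewrite /cphi /y; ring.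
rewrite /F /fourier_energy (cantor_measure_integral muD D0 (bcont_cos xi)).
rewrite (cantor_measure_integral muD D0 (bcont_sin xi)).
set c := \int[mu]_x cos (y * x); set s := \int[mu]_x sin (y * x).
have -> : \sum_(d in D) \int[mu]_x cos (xi * cphi M d x) =
    (\sum_(d in D) cos (d%:R * y)) * c - (\sum_(d in D) sin (d%:R * y)) * s.
  rewrite !mulr_suml -sumrB; apply: eq_bigr => d _.
  rewrite -mulNr -Rintegral_lin; [|exact: bcont_cos|exact: bcont_sin].
  by apply: eq_Rintegral => x _; rewrite e cosD mulNr.
have -> : \sum_(d in D) \int[mu]_x sin (xi * cphi M d x) =
    (\sum_(d in D) sin (d%:R * y)) * c + (\sum_(d in D) cos (d%:R * y)) * s.
  rewrite !mulr_suml -big_split; apply: eq_bigr => d _ /=.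
  rewrite -Rintegral_lin; [|exact: bcont_cos|exact: bcont_sin].
  by apply: eq_Rintegral => x _; rewrite e sinD.
by rewrite /mask_energy; field.
Qed.

Lemma fourier_energy_le_div xi (a : nat) : F xi <= F (xi / M%:R ^+ a).
Proof.
elim: a => [|a IH]; first by rewrite divr1.
apply: le_trans IH _; rewrite fourier_energy_selfsimilar exprSr invfM mulrA.
by rewrite ler_piMl ?fourier_energy_ge0 // mask_energy_le1 // ltnW.
Qed.

(* Take [t] close to [s = M^(r L) / (M^r - 1)]: modulo 1, all of
   [s / M^(r j)], [j <= L], equal [1 / (M^r - 1)], so [L] factors of the
   infinite product for the Fourier transform stay away from 1. *)
Lemma fourier_energy_decay (N W : nat) (e : R) :
  (1 < N)%N -> mult_independent M N -> 0 < e ->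
  exists k : nat, forall g : nat, (0 < g <= W)%N ->
    F ((pi *+ 2) * (g * N ^ k)%:R) <= e.
Proof.
move=> N1 ind e0.
(* This size of [r] gives [2 W M < Q], which keeps the phases of all [g <= W] in the range where the
   mask is bounded away from 1. *)
pose r := (2 * W * M).+1; pose Q : R := M%:R ^+ r - 1.
have WQ : 2 * W%:R * M%:R + 1 <= Q.
  have := ltn_expl r M1; rewrite -(ler_nat R) natrX /Q /r -!natr1 !natrM; lra.
have W0 : 0 <= W%:R * M%:R :> R by rewrite mulr_ge0 // ltW.
have Q0 : 0 < Q by lra.
have p0 := pi_gt0 R.
have p20 : 0 < pi *+ 2 :> R by rewrite mulr2n addr_gt0.
(* The lower end [pi / Q] is [2 pi] times [1 / (2 Q)], the smallest residue that occurs below. *)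
have [||rho /andP[rho0 rho1] mask_rho] := @mask_energy_bound R M D (pi / Q) D1.
- by rewrite divr_gt0.
- have : M%:R <= Q + 1.
    by rewrite /Q subrK -natrX ler_nat; apply: leq_trans (leq_pexp2l (ltnW M1) (_ : 1 <= r)%N).
  have : 2 <= Q + 1.
    by rewrite /Q subrK -natrX ler_nat; apply: leq_trans (leq_pexp2l (ltnW M1) (_ : 1 <= r)%N).
  move=> *; rewrite mulrAC ler_pdivrMr // (_ : pi *+ 2 * Q = pi * (2 * Q)); last by ring.
  by rewrite ler_pM2l //; lra.
(* The factor 2 is the crude bound on the energy left over after [L] factors [rho]. *)
have [L rhoL] : exists L : nat, 2 * rho ^+ L <= e.
  have rho1' : `|rho| < 1 by rewrite ger0_norm.
  have e20 : 0 < e / 2 by rewrite divr_gt0.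
  have [L _ /(_ L (leqnn L))] := @cvgr_dist_lt _ _ _ _ _ _ _ (cvg_expr rho1') _ e20.
  rewrite /= sub0r normrN ger0_norm ?exprn_ge0 // => rhoL; exists L.
  by rewrite mulrC -ler_pdivlMr // ltW.
have M1Q : M%:R ^+ r = Q + 1 by rewrite /Q subrK.
(* [M^r] is congruent to 1 modulo [Q], hence so are its powers. *)
have mod1 n : exists m : nat, M%:R ^+ (r * n) / Q = m%:R + Q^-1.
  elim: n => [|n [m IH]]; first by exists 0%N; rewrite muln0 div1r add0r.
  exists (m + M ^ (r * n))%N; rewrite mulnS exprD M1Q natrD natrX.
  by rewrite mulrDl mulrDl mul1r IH mulrAC divff ?gt_eqF //; ring.
(* The tolerance is half of the residue [1 / Q], and division by powers of [M] only shrinks the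
   error. The choice of [k] and [a] does not involve [g]. *)
have [||k [a hka]] := @pow_ratio_dense R M N (M%:R ^+ (r * L) / Q) (2 * Q)^-1 M1 N1 ind.
- by rewrite divr_gt0 // exprn_gt0.
- by rewrite invr_gt0 mulr_gt0.
exists k => g /andP[g0 gW].
set t := N%:R ^+ k / M%:R ^+ a in hka.
apply: le_trans (fourier_energy_le_div _ a) _.
have -> : pi *+ 2 * (g * N ^ k)%:R / M%:R ^+ a = pi *+ 2 * g%:R * t.
  by rewrite /t natrM natrX; ring.
have step j : (j <= L)%N ->
    F (pi *+ 2 * g%:R * t) <= rho ^+ j * F (pi *+ 2 * g%:R * (t / M%:R ^+ (r * j))).
  elim: j => [_|j IH jL]; first by rewrite muln0 divr1 mul1r.
  apply: le_trans (IH (ltnW jL)) _; rewrite exprSr -[leRHS]mulrA ler_wpM2l ?exprn_ge0 //.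
  (* In each block of [r] factors, the first [r - 1] are bounded by 1 and the last one by [rho]. *)
  apply: le_trans (fourier_energy_le_div _ r.-1) _.
  rewrite fourier_energy_selfsimilar.
  set z := (X in mask_energy D X).
  have zE : z = pi *+ 2 * g%:R * (t / M%:R ^+ (r * j.+1)).
    by rewrite /z mulnS (exprD _ r) -(prednK (isT : (0 < r)%N)) exprSr !invfM; ring.
  rewrite -zE ler_wpM2r ?fourier_energy_ge0 //.
  have [m mE] := mod1 (L - j.+1)%N.
  (* [u] is the residue of the phase modulo 1, in units of [2 pi]; it lies between [1 / (2 Q)] and
     [3 / (2 Q)]. *)
  pose u := t / M%:R ^+ (r * j.+1) - m%:R.
  have -> : z = pi *+ 2 * g%:R * u + pi *+ 2 * (g * m)%:R.
    by rewrite zE /u natrM; ring.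
  rewrite mask_energyD2pin.
  have Mj1 : 1 <= M%:R ^+ (r * j.+1) :> R by rewrite exprn_ege1 // ler1n ltnW.
  have Mj0 : 0 < M%:R ^+ (r * j.+1) :> R by apply: lt_le_trans Mj1.
  have uQ : `|u - Q^-1| <= (2 * Q)^-1.
    have -> : u - Q^-1 = (t - M%:R ^+ (r * L) / Q) / M%:R ^+ (r * j.+1).
      rewrite /u -addrA -opprD -mE mulrBl; congr (_ - _).
      have -> : M%:R ^+ (r * L) = M%:R ^+ (r * (L - j.+1)) * M%:R ^+ (r * j.+1) :> R.
        by rewrite -exprD -mulnDr subnK.
      by rewrite [RHS]mulrAC mulfK // gt_eqF.
    rewrite normrM (gtr0_norm (_ : 0 < _^-1)) ?invr_gt0 //.
    rewrite ler_pdivrMr //; apply: le_trans (ltW hka) _.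
    by rewrite ler_peMr // invr_ge0 mulr_ge0 // ltW.
  move: uQ; rewrite invfM ler_norml => /andP[u1 u2].
  have iQ : 0 < Q^-1 by rewrite invr_gt0.
  have g1 : 1 <= g%:R :> R by rewrite ler1n.
  have gWR : g%:R <= W%:R :> R by rewrite ler_nat.
  have u0 : Q^-1 / 2 <= u by lra.
  apply: mask_rho.
    rewrite (_ : pi *+ 2 * g%:R * u = pi * (2 * (g%:R * u))); last by ring.
    rewrite ler_pM2l //.
    have : 1 * u <= g%:R * u by rewrite ler_wpM2r //; lra.
    lra.
  rewrite -[leRHS]mulr1 -!mulrA ler_pM2l //.
  have : g%:R * (u * M%:R) <= W%:R * (2 * Q^-1 * M%:R).
    apply: ler_pM => //; first by rewrite mulr_ge0 ?ltW //; lra.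
    by rewrite ler_pM2r //; lra.
  move=> h; apply: le_trans h _.
  rewrite (_ : _ * _ = (2 * W%:R * M%:R) / Q); last by ring.
  by rewrite ler_pdivrMr //; lra.
apply: le_trans (step L (leqnn L)) _; apply: le_trans rhoL.
by rewrite mulrC ler_wpM2r ?exprn_ge0 // fourier_energy_le2.
Qed.

End Decay.

(** * Cantor sets of another scale factor *)

(** Expanding the minimum [a] and the maximum [b] of [K] by one digit gives [a * N >= a] and
    [b * N <= b + N - 1]. *)
Lemma cantor_set_bounds (R : realType) (N : nat) (C : {set 'I_N}) (K : set R) (x : R) :
  (1 < N)%N -> is_cantor_set C K -> K x -> 0 <= x <= 1.
Proof.
move=> N1 [cK [K0 Keq]] Kx.
have N1R : 1 < N%:R :> R by rewrite ltr1n.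
have N0R : 0 < N%:R :> R by lra.
have digit z : K z -> exists2 y, K y & exists2 d : 'I_N, d \in C & z * N%:R = y + d%:R.
  rewrite {1}Keq => -[d dC [y Ky <-]]; exists y => //; exists d => //.
  by rewrite /cphi divfK // gt_eqF.
have cid : {within K, continuous (@id R)} by apply: continuous_subspaceT => z; exact: cvg_id.
have [a /set_mem Ka amin] := compact_EVT_min K0 cK cid.
have [b /set_mem Kb bmax] := compact_EVT_max K0 cK cid.
have [y Ky [d _ ya]] := digit _ Ka; have [z Kz [e _ zb]] := digit _ Kb.
have ay := amin _ (mem_set Ky); have zb' := bmax _ (mem_set Kz).
have ax := amin _ (mem_set Kx); have xb := bmax _ (mem_set Kx).
have d0 : 0 <= d%:R :> R by [].
have eN : e%:R + 1 <= N%:R :> R by rewrite natr1 ler_nat.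
have a0 : 0 <= a by rewrite -(pmulr_lge0 _ (_ : 0 < N%:R - 1)) ?mulrBr; lra.
have b1 : b <= 1 by rewrite -(ler_pM2r (_ : 0 < N%:R - 1)) ?mulrBr; lra.
by apply/andP; split; lra.
Qed.

(** Each multiplication by [N] strips one digit: modulo 1, [K] is mapped into itself. *)
Lemma cantor_set_expansion (R : realType) (N : nat) (C : {set 'I_N}) (K : set R)
    (x : R) (k : nat) :
  (0 < N)%N -> is_cantor_set C K -> K x ->
  exists2 y, K y & exists m : nat, N%:R ^+ k * x = y + m%:R.
Proof.
move=> N0 [_ [_ Keq]] Kx; elim: k => [|k [y Ky [m e]]].
  by exists x => //; exists 0%N; rewrite mul1r addr0.
move: Ky; rewrite {1}Keq => -[d dC [z Kz zy]]; exists z => //; exists (d + N * m)%N.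
rewrite exprS -mulrA e -zy /cphi natrD natrM mulrDr mulrC divfK ?addrA //.
by rewrite pnatr_eq0 -lt0n.
Qed.

(** A missing digit leaves a hole around some [x0]. By compactness [K] stays away from [x0] modulo
    1, and so do all [N^k x], which lie in [K] modulo 1. *)
Lemma cantor_set_gap (R : realType) (N : nat) (C : {set 'I_N}) (K : set R) :
  cantor_data C -> is_cantor_set C K ->
  exists x0 eta : R, 0 < eta /\ forall x k, K x ->
    eta <= 1 - cos (pi *+ 2 * (N%:R ^+ k * x - x0)).
Proof.
move=> [N3 [C2 CN]] KC; have [cK [K0 Keq]] := KC.
have N1 : (1 < N)%N by apply: leq_trans N3.
have N0R : 0 < N%:R :> R by rewrite ltr0n ltnW.
have [e eC] : exists e, e \notin C.
  apply/existsP; rewrite -negb_forall; apply/negP => /forallP allC.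
  have : #|C| = N by rewrite -[RHS]card_ord; apply: eq_card => i; rewrite allC.
  by move=> cC; move: CN; rewrite cC leqNgt prednK ?leqnn // ltnW.
(* The midpoint of the interval of the missing digit; an endpoint could be reached from a
   neighbouring digit. *)
pose x0 : R := (e%:R + 2^-1) / N%:R.
have e0 : 0 <= e%:R :> R by [].
have eN : e%:R + 1 <= N%:R :> R by rewrite natr1 ler_nat.
have x0_gt0 : 0 < x0 by rewrite divr_gt0 //; lra.
have x0_lt1 : x0 < 1 by rewrite ltr_pdivrMr // mul1r; lra.
have Kx0 : ~ K x0.
  rewrite Keq => -[d /= dC [y Ky]]; rewrite /cphi /x0 => /(mulIf _).
  rewrite invr_eq0 gt_eqF // => /(_ isT) yd.
  have /andP[y0 y1] := cantor_set_bounds N1 KC Ky.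
  have de : d = e :> nat.
    by case: (ltngtP (d : nat) e) => // l; exfalso; have := l; rewrite -(ler_nat R) -natr1; lra.
  by move: eC; rewrite -(val_inj de) dC.
pose f y := 1 - cos (pi *+ 2 * (y - x0)).
have cf : continuous f.
  move=> y; apply: cvgB; first exact: cvg_cst.
  apply: (@continuous_comp _ _ _ (fun y => pi *+ 2 * (y - x0)) cos); last exact: continuous_cos.
  by apply: cvgM; [exact: cvg_cst|apply: cvgB; [exact: cvg_id|exact: cvg_cst]].
have [c /set_mem Kc cmin] := compact_EVT_min K0 cK (continuous_subspaceT cf).
exists x0, (f c); split.
  rewrite subr_gt0 -cos_norm; apply: cos_lt1.
  have p2 : 0 < pi *+ 2 :> R by rewrite mulr2n addr_gt0 // pi_gt0.
  have /andP[c0 c1] := cantor_set_bounds N1 KC Kc.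
  rewrite normrM (gtr0_norm p2) mulr_gt0 //=; last first.
    by rewrite normr_gt0 subr_eq0; apply/eqP => ce; apply: Kx0; rewrite -ce.
  rewrite gtr_pMr // ltr_norml; apply/andP; split; lra.
move=> x k Kx; have [y Ky [m ->]] := cantor_set_expansion k (ltnW N1) KC Kx.
rewrite (_ : pi *+ 2 * (y + m%:R - x0) = pi *+ 2 * (y - x0) + pi *+ 2 * m%:R); last by ring.
by rewrite cosD2pin; apply: cmin; exact: mem_set.
Qed.

(** Away from 0 modulo [2 pi] the kernel is at most half of its constant term [n], so the cosine
    sums [A h] must compensate by being negative on weighted average. This forces the sum of their
    squares to be large. *)
Lemma fejer_energy_lower (R : realType) (n H : nat) (eta : R) (t : 'I_H -> R) :
  (0 < n)%N -> (0 < H)%N -> 4 <= eta * n%:R ->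
  (forall i, eta <= 1 - cos (t i)) ->
  H%:R ^+ 2 / (16 * n%:R) <=
  \sum_(1 <= h < n) \sum_(i < H) \sum_(j < H) cos (h%:R * t i - h%:R * t j).
Proof.
move=> n0 H0 etan eta_t.
have nR : 0 < n%:R :> R by rewrite ltr0n.
have HR : 0 < H%:R :> R by rewrite ltr0n.
have eta0 : 0 < eta by rewrite -(pmulr_lgt0 _ nR); lra.
pose A h := \sum_(i < H) cos (h%:R * t i).
have A2 h : A h ^+ 2 <= \sum_(i < H) \sum_(j < H) cos (h%:R * t i - h%:R * t j).
  by rewrite -sqr_sum_cos_sin lerDl sqr_ge0.
have kernel i : n%:R + 2 * \sum_(1 <= h < n) (n%:R - h%:R) * cos (h%:R * t i) <= n%:R / 2.
  have t1 : 0 < 1 - cos (t i) by apply: lt_le_trans (eta_t i).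
  rewrite -(ler_pM2l t1) fejer_kernel.
  have := cos_geN1 (n%:R * t i).
  have : eta * n%:R <= (1 - cos (t i)) * n%:R by rewrite ler_pM2r.
  lra.
have sumA : H%:R * n%:R / 2 <= \sum_(1 <= h < n) - (2 * (n%:R - h%:R) * A h).
  have swap : \sum_(i < H) (n%:R + 2 * \sum_(1 <= h < n) (n%:R - h%:R) * cos (h%:R * t i)) =
      H%:R * n%:R + \sum_(1 <= h < n) 2 * (n%:R - h%:R) * A h.
    rewrite big_split /= sumr_const card_ord -[n%:R *+ H]mulr_natl; congr (_ + _).
    rewrite -mulr_sumr exchange_big mulr_sumr; apply: eq_bigr => h _.
    by rewrite -mulr_sumr mulrA.
  have := @ler_sum _ _ (index_enum 'I_H) xpredT _ _ (fun i _ => kernel i).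
  rewrite swap sumr_const card_ord -[_ / 2 *+ H]mulr_natl sumrN; lra.
(* Completing a square; the weights are such that the constants [H / 4] add up to at most half of
   the lower bound in [sumA]. *)
have termA h : (1 <= h < n)%N ->
    - (2 * (n%:R - h%:R) * A h) <= H%:R / 4 + 4 * n%:R ^+ 2 / H%:R * A h ^+ 2.
  move=> /andP[h1 hn]; have hnR : h%:R <= n%:R :> R by rewrite ler_nat ltnW.
  have h0 : 0 <= h%:R :> R by [].
  have sq : 0 <= (H%:R / 2 + 2 * (n%:R - h%:R) * A h) ^+ 2 / H%:R.
    by rewrite divr_ge0 ?sqr_ge0 // ltW.
  have sqE : (H%:R / 2 + 2 * (n%:R - h%:R) * A h) ^+ 2 / H%:R =
    H%:R / 4 + 2 * (n%:R - h%:R) * A h + 4 * (n%:R - h%:R) ^+ 2 / H%:R * A h ^+ 2.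
    by field; rewrite gt_eqF.
  have : 4 * (n%:R - h%:R) ^+ 2 / H%:R * A h ^+ 2 <= 4 * n%:R ^+ 2 / H%:R * A h ^+ 2.
    rewrite ler_wpM2r ?sqr_ge0 // ler_pM2r ?invr_gt0 // ler_pM2l //.
    by rewrite lerXn2r ?nnegrE //; lra.
  rewrite sqE in sq; lra.
have upper : \sum_(1 <= h < n) - (2 * (n%:R - h%:R) * A h) <=
    n%:R * (H%:R / 4) + 4 * n%:R ^+ 2 / H%:R * \sum_(1 <= h < n) A h ^+ 2.
  rewrite big_nat_cond; apply: le_trans (ler_sum _ (fun h hP => termA h (proj1 (andP hP)))) _.
  rewrite -big_nat_cond big_split /= sumr_const_nat mulr_sumr lerD2r -[leLHS]mulr_natl.
  by rewrite ler_pM2r ?divr_gt0 // ler_nat leq_subr.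
apply: le_trans (_ : \sum_(1 <= h < n) A h ^+ 2 <= _); last by apply: ler_sum.
rewrite ler_pdivrMr ?mulr_gt0 //.
set S := \sum_(1 <= h < n) A h ^+ 2 in upper *.
have := le_trans sumA upper => main.
have : H%:R * n%:R / 4 <= 4 * n%:R ^+ 2 / H%:R * S by lra.
rewrite -(ler_pM2r (_ : 0 < 4 * H%:R / n%:R)) ?divr_gt0 ?mulr_gt0 //.
rewrite (_ : H%:R * n%:R / 4 * _ = H%:R ^+ 2); last by field; rewrite gt_eqF.
rewrite (_ : _ * S * _ = S * (16 * n%:R)) //.
by field; rewrite !gt_eqF.
Qed.

(** * Almost orthogonality against the lower bound on the Cantor set *)

Section NullIntersection.
Variables (R : realType) (M N : nat) (B : {set 'I_M}) (C : {set 'I_N}).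
Variables (mu : probability R R) (K : set R).
Hypothesis B1 : (1 < #|B|)%N.
Hypothesis dataC : cantor_data C.
Hypothesis ind : mult_independent M N.
Hypothesis muB : is_cantor_measure B mu.
Hypothesis KC : is_cantor_set C K.

Let N1 : (1 < N)%N.
Proof. by case: dataC => N3 _; apply: leq_trans N3. Qed.

Lemma Rintegral_cos_decay (n H : nat) : (0 < H)%N ->
  exists k : nat, forall h i j : nat, (0 < h < n)%N -> (i < H)%N -> (j < H)%N ->
    \int[mu]_x cos (pi *+ 2 * (h%:R * (N%:R ^+ (k + i) - N%:R ^+ (k + j))) * x)
    <= (i == j)%:R + H%:R^-1 :> R.
Proof.
move=> H0; have HR : 0 < H%:R^-1 :> R by rewrite invr_gt0 ltr0n.
(* Off the diagonal the frequency is, up to sign, [2 pi g N^k] with [0 < g <= n N^H]. An energy of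
   at most [H^-2] bounds the cosine integral by [1 / H]. *)
have [|k decay] := fourier_energy_decay muB B1 (n * N ^ H) N1 ind (e := H%:R^-1 ^+ 2).
  exact: exprn_gt0.
exists k => h i j hn iH jH.
have [->|ij] := eqVneq i j.
  rewrite subrr !mulr0; under eq_Rintegral => x _ do rewrite mul0r cos0.
  by rewrite (Rintegral_prob_cst mu 1) lerDl ltW.
rewrite add0r; wlog lij : i j iH jH ij / (j < i)%N.
  move=> W; case: (ltngtP i j) ij => // l _; last by apply: W => //; rewrite gtn_eqF.
  under eq_Rintegral => x _ do rewrite -cosN -mulNr -mulrN -mulrN opprB.
  by apply: W => //; rewrite gtn_eqF.
have Nij : (N ^ j < N ^ i)%N by rewrite ltn_exp2l.
have gW : (0 < h * (N ^ i - N ^ j) <= n * N ^ H)%N.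
  have /andP[h0 hn'] := hn.
  rewrite muln_gt0 h0 subn_gt0 Nij /= leq_mul // ?(ltnW hn') //.
  by apply: leq_trans (leq_subr _ _) _; rewrite leq_exp2l // ltnW.
have gE : h%:R * (N%:R ^+ (k + i) - N%:R ^+ (k + j)) =
    (h * (N ^ i - N ^ j) * N ^ k)%:R :> R.
  by rewrite !natrM natrB ?(ltnW Nij) // !natrX !exprD; ring.
rewrite gE; have {}decay := decay _ gW.
set c := (X in X <= _).
have : c ^+ 2 <= H%:R^-1 ^+ 2 by apply: le_trans decay; rewrite lerDl sqr_ge0.
have [c0|/ltW c0 _] := leP 0 c; last by apply: le_trans c0 (ltW HR).
by rewrite ler_pXn2r // nnegrE ltW.
Qed.

(** The nonnegative [E] is at least [H^2 / (16 n)] on [K] while its integral is at most [2 n H].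
    Since [n] depends only on the gap, [H] can tend to infinity. *)
Lemma cantor_measure_cantor_set_eq0 : mu K = 0%E.
Proof.
have [cK _] := KC; have mK := compact_measurable cK.
have muK_fin : mu K \is a fin_num by exact: fin_num_measure.
have [x0 [eta [eta0 gap]]] := cantor_set_gap dataC KC.
pose n := (Num.trunc (4 / eta)).+1.
have etan : 4 <= eta * n%:R.
  by rewrite mulrC -ler_pdivrMr //; apply/ltW/truncnS_gt.
have nR : 0 < n%:R :> R by rewrite ltr0n.
have bound H : (0 < H)%N -> fine (mu K) <= 32 * n%:R ^+ 2 / H%:R.
  move=> H0; have HR : 0 < H%:R :> R by rewrite ltr0n.
  have [k decay] := Rintegral_cos_decay n H0.
  pose xi h (i j : 'I_H) : R := pi *+ 2 * (h%:R * (N%:R ^+ (k + i) - N%:R ^+ (k + j))).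
  pose E x := \sum_(1 <= h < n) \sum_(i < H) \sum_(j < H) cos (xi h i j * x).
  have tE2 h i : bcont (fun x => \sum_(j < H) cos (xi h i j * x)).
    by apply: bcont_sum => j; exact: bcont_cos.
  have tE1 h : bcont (fun x => \sum_(i < H) \sum_(j < H) cos (xi h i j * x)).
    by apply: bcont_sum => i.
  have tE : bcont E by apply: bcont_sum.
  (* The shift by [x0] cancels in differences of phases, so the same [E] serves the gap estimate and
     the integral estimate. *)
  have xiE h (i j : 'I_H) x : xi h i j * x =
    h%:R * (pi *+ 2 * (N%:R ^+ (k + i) * x - x0)) -
    h%:R * (pi *+ 2 * (N%:R ^+ (k + j) * x - x0)).
    by rewrite /xi; ring.
  have E_ge0 x : 0 <= E x.
    apply: sumr_ge0 => h _.
    under eq_bigr => i _ do under eq_bigr => j _ do rewrite xiE.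
    by rewrite -sqr_sum_cos_sin addr_ge0 ?sqr_ge0.
  have E_K x : K x -> H%:R ^+ 2 / (16 * n%:R) <= E x.
    move=> Kx; rewrite /E.
    under eq_bigr => h _ do under eq_bigr => i _ do under eq_bigr => j _ do rewrite xiE.
    by apply: (fejer_energy_lower _ H0 etan) => // i; exact: gap.
  have intE : \int[mu]_x E x <= n%:R * (2 * H%:R).
    rewrite Rintegral_sum // big_nat_cond.
    apply: (@le_trans _ _ (\sum_(1 <= h < n | (1 <= h < n)%N && true) 2 * H%:R)); last first.
      rewrite -big_nat_cond sumr_const_nat -[leLHS]mulr_natl ler_wpM2r ?mulr_ge0 //.
      by rewrite ler_nat leq_subr.
    apply: ler_sum => h; rewrite andbT => hn; rewrite Rintegral_sum //.
    apply: (@le_trans _ _ (\sum_(i < H) 2)); last by rewrite sumr_const card_ord -[leLHS]mulr_natr.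
    apply: ler_sum => i _; rewrite Rintegral_sum; last by move=> j; exact: bcont_cos.
    (* Each row contributes 1 from the diagonal and [H] times [1 / H] from the error terms. *)
    apply: (@le_trans _ _ (\sum_(j < H) ((i == j)%:R + H%:R^-1))).
      by apply: ler_sum => j _; exact: decay.
    rewrite big_split /= sumr_const card_ord -[_^-1 *+ H]mulr_natr mulVf ?gt_eqF //.
    rewrite (bigD1 i) //= eqxx big1 ?addr0 // => j; rewrite eq_sym => /negbTE -> //.
  have : H%:R ^+ 2 / (16 * n%:R) * fine (mu K) <= \int[mu]_x E x.
    have int_indic : mu.-integrable setT (EFin \o (\1_K : R -> R)).
      by apply: integrable_indic => //; rewrite ltey_eq fin_num_measure.
    have -> : fine (mu K) = \int[mu]_x \1_K x.
      by rewrite /Rintegral integral_indic // setIT.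
    rewrite -RintegralZl //; apply: le_Rintegral => //.
    - exact: (integrableZl measurableT _ int_indic).
    - exact: bcont_integrable.
    move=> x _; rewrite indicE; have [xK|_] := boolP (x \in K).
      by rewrite mulr1; apply/E_K/set_mem.
    by rewrite mulr0.
  move=> /le_trans /(_ intE) h.
  rewrite ler_pdivlMr //.
  have h2 := h; rewrite -(ler_pM2r (_ : 0 < 16 * n%:R / H%:R)) ?divr_gt0 ?mulr_gt0 // in h2.
  rewrite (_ : _ * fine (mu K) * _ = fine (mu K) * H%:R) in h2; last by field; rewrite !gt_eqF.
  by rewrite (_ : _ * (2 * _) * _ = 32 * n%:R ^+ 2) in h2; last by field; rewrite gt_eqF.
have muK0 : 0 <= fine (mu K) by exact: fine_ge0.
rewrite -(fineK muK_fin); congr (_%:E); apply/eqP; rewrite eq_le muK0 andbT leNgt.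
apply/negP => pos.
have n2 : 0 < 32 * n%:R ^+ 2 :> R by rewrite mulr_gt0 // exprn_gt0.
pose H := (Num.trunc (32 * n%:R ^+ 2 / fine (mu K))).+1.
have := bound H isT; rewrite leNgt => /negP; apply.
by rewrite ltr_pdivrMr ?ltr0n // [ltRHS]mulrC -ltr_pdivrMr //; exact: truncnS_gt.
Qed.

End NullIntersection.

Lemma mult_independent_sym (M N : nat) : mult_independent M N -> mult_independent N M.
Proof. by move=> ind m n /esym /ind []. Qed.

Theorem theorem2p4 (R : realType) (M N : nat)
    (B : {set 'I_M}) (C : {set 'I_N})
    (KB KC : set R) (muB muC : probability R R) :
  cantor_data B -> cantor_data C ->
  mult_independent M N ->
  is_cantor_set B KB -> is_cantor_set C KC ->
  is_cantor_measure B muB -> is_cantor_measure C muC ->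
  muB (KB `&` KC) = 0%E /\ muC (KB `&` KC) = 0%E.
Proof.
move=> dB dC ind cKB cKC mB mC.
have mKB := compact_measurable cKB.1; have mKC := compact_measurable cKC.1.
have mI := measurableI _ _ mKB mKC.
have [[_ [B1 _]] [_ [C1 _]]] := (dB, dC).
split; apply: (subset_measure0 mI).
- exact: mKC.
- exact: subIsetr.
- exact: cantor_measure_cantor_set_eq0 B1 dC ind mB cKC.
- exact: mKB.
- exact: subIsetl.
- exact: cantor_measure_cantor_set_eq0 C1 dB (mult_independent_sym ind) mC cKB.
Qed.
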